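(* Let $\{d_n\}_{n=0}^\infty$ be a sequence of integers with $0\le d_n\le n$ for all $n$. Let $$k_1=\sup\left\{t\in\mathbb{N}:\sum_{n=1}^\infty\left(\frac{d_n}{n}\right)^t\left(\frac{n-d_n}{n}\right)^t=\infty\right\},\qquad k_2=\sup\left\{t\in\mathbb{N}:\sum_{n=1}^\infty\frac{(d_n)_{(t)}(n-d_n)_{(t)}}{(n)_{(2t)}}=\infty\right\},$$ where $\mathbb{N}=\{0,1,2,\ldots\}$ and the suprema may be $\infty$. Then $k_1=k_2$, and the random graph process with sequence $\{d_n\}$ almost surely generates a graph of radocity $k_1$ (which equals $k_2$).
   Context: Random graph process with sequence $\{d_n\}$: the vertex set is $\{v_0,v_1,v_2,\ldots\}$. In round $i=0,1,2,\ldots$, independently of the other rounds, a subset $A\subseteq\{v_0,\ldots,v_{i-1}\}$ of cardinality $d_i$ is chosen uniformly at random among all subsets of that cardinality, and $v_i$ is joined by an edge to every vertex of $A$. The result is a random graph on countably many vertices. For a graph $G$ and $A,B\subseteq V(G)$, a vertex $v$ is a witness for the ordered pair $(A,B)$ if $v$ is adjacent to every vertex of $A$ and to no vertex of $B$. For a nonnegative integer $k$, $G$ is $k$-Rado if every pair of disjoint sets of vertices $(A,B)$ with $|A|\le k$ and $|B|\le k$ has infinitely many witnesses. The radocity of $G$ is $\mathrm{rado}(G)=\sup\{k: G\text{ is }k\text{-Rado}\}$ (possibly $\infty$). Notation: $n_{(k)}=n(n-1)\cdots(n-k+1)$, with $n_{(0)}=1$ (even if $n=0$). Also $0^0=1$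 whenever this power appears in a term of a series. In the second series, the finitely many terms with $n<2t$ (which have the form $0/0$) are read as $0$. *)

(* Defs.v *)
From HB Require Import structures.
From mathcomp Require Import all_boot all_order all_algebra finmap.
From mathcomp Require Import all_classical all_reals all_analysis.
Set Implicit Arguments.
Unset Strict Implicit.
Unset Printing Implicit Defensive.
Import Order.TTheory GRing.Theory Num.Theory.
Import numFieldNormedType.Exports.

Local Open Scope classical_set_scope.
Local Open Scope ring_scope.
Local Open Scope ereal_scope.

(* For an infinite vertex set the sets used below all contain 0, so the value
   -oo that [ereal_sup] gives to the empty set does not occur. *)
Definition nat_sup (R : realType) (S : set nat) : \bar R :=
  ereal_sup [set (t%:R)%:E | t in S].

Record sgraph (V : Type) := SGraph {
  adj : rel V;
  adj_sym : symmetric adj;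
  adj_irr : irreflexive adj }.

Definition witness (V : choiceType) (G : sgraph V) (A B : {fset V}) (v : V) :
    Prop :=
  (forall a, a \in A -> adj G v a) /\ (forall b, b \in B -> ~~ adj G v b).

Definition k_rado (V : choiceType) (G : sgraph V) (k : nat) : Prop :=
  forall A B : {fset V}, [disjoint A & B]%fset ->
    (#|` A| <= k)%N -> (#|` B| <= k)%N -> infinite_set [set v | witness G A B v].

Definition radocity (R : realType) (V : choiceType) (G : sgraph V) : \bar R :=
  nat_sup R [set k | k_rado G k].

Section process_graph.
Variable A : forall i : nat, {set 'I_i}.

Definition process_adj (u v : nat) : bool :=
  (u \in [seq val j | j in A v]) || (v \in [seq val j | j in A u]).

Lemma process_adj_sym : symmetric process_adj.
Proof. by move=> u v; rewrite /process_adj orbC. Qed.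

Lemma process_adj_irr : irreflexive process_adj.
Proof.
move=> u; rewrite /process_adj orbb; apply/negbTE/negP => /mapP[j _ eq_uj].
by have := ltn_ord j; rewrite -[X in (X < _)%N]/(val j) -eq_uj ltnn.
Qed.

(* Vertex v_i is the natural number i; A i is the set of indices of the earlier
   vertices to which v_i is joined in round i. *)
Definition process_graph : sgraph nat :=
  SGraph process_adj_sym process_adj_irr.

End process_graph.

(* As each T i is finite, measurability of the fibres of X i (see
   [random_graph_process]) makes all the events below measurable. *)
Definition mutually_independent (R : realType) (disp : measure_display)
    (Omega : measurableType disp) (P : probability Omega R)
    (I : choiceType) (T : I -> finType) (X : forall i, Omega -> T i) : Prop :=
  forall (J : {fset I}) (B : forall i, {set T i}),
    P (\bigcap_(i in [set` J]) [set w | X i w \in B i]) =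
    \prod_(i <- enum_fset J) P [set w | X i w \in B i].

Record random_graph_process (R : realType) (d : nat -> nat)
    (disp : measure_display) (Omega : measurableType disp)
    (P : probability Omega R) (A : forall i : nat, Omega -> {set 'I_i}) :
    Prop := RandomGraphProcess {
  process_measurable : forall i (S : {set 'I_i}),
    measurable [set w | A i w = S];
  process_uniform : forall i (S : {set 'I_i}),
    P [set w | A i w = S] =
    (if #|S| == d i
     then ((#|[set S' : {set 'I_i} | #|S'| == d i]%SET|)%:R^-1)%:E
     else 0);
  process_independent : mutually_independent P A }.

(* In MathComp x ^+ 0 = 1 also for x = 0. *)
Definition k1 (R : realType) (d : nat -> nat) : \bar R :=
  nat_sup R [set t : nat |
    \sum_(1 <= n <oo)
      (((d n)%:R / n%:R) ^+ t * ((n - d n)%:R / n%:R) ^+ t : R)%:E = +oo].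

(* m ^_ t is the falling factorial. For n < 2t its value at (n, 2t) is 0, and
   x / 0 = 0 in MathComp, so these terms are 0. *)
Definition k2 (R : realType) (d : nat -> nat) : \bar R :=
  nat_sup R [set t : nat |
    \sum_(1 <= n <oo)
      (((d n) ^_ t)%:R * ((n - d n) ^_ t)%:R / (n ^_ (2 * t))%:R : R)%:E = +oo].

(* Main.v *)
Require Import Defs.
From mathcomp Require Import all_boot all_order all_algebra finmap.
From mathcomp Require Import all_classical all_reals all_analysis.
From mathcomp Require Import lra ring zify.

Set Implicit Arguments.
Unset Strict Implicit.
Unset Printing Implicit Defensive.
Import Order.TTheory GRing.Theory Num.Theory.

(** The idea is that each witness is decided by one round. Fix disjoint sets X
    and Y of exactly t vertices. A vertex n that comes after all of them is a
    witness for (X, Y) iff the set drawn in round n contains X and misses Y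
    ([witness_separating]); counting draws, this has probability
    (d_n)_(t) (n - d_n)_(t) / (n)_(2t), the term of the second series
    ([probability_separating]). The rounds are independent, so by the two
    Borel-Cantelli lemmas the pair almost surely has infinitely many witnesses if
    that series diverges, and finitely many if it converges
    ([borel_cantelli_separating]).

    There are countably many triples (X, Y, t), so almost surely all these
    alternatives hold at once. If the series for t diverges, the graph is then
    t-Rado: a pair with at most t vertices on each side extends to a disjoint pair
    with exactly t on each side ([disjoint_extension]), and witnesses for the larger
    pair are witnesses for the smaller one. If it converges, any one disjoint
    pair with t vertices on each side shows that the graph is not t-Rado. Hence
    the radocity is the supremum k2.

    That k1 = k2 is deterministic: for each t the two series diverge together
    ([k_series_pinfty_iff]), since their terms are within constant factors of each
    other when d_n and n - d_n are at least t, and the remaining terms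
    contribute a finite amount to both. *)

(** * Counting draws *)

(** Both sides count the d-sets in n points together with an ordered choice of t
    points inside and t points outside: on the left these 2t points are chosen
    first, on the right the d-set is. When n - d < t both sides vanish; otherwise
    all factors are expanded into factorials. *)
Lemma bin_ffact_separated (n d t : nat) :
  (d <= n)%N -> (2 * t <= n)%N -> (t <= d)%N ->
  ('C(n - 2 * t, d - t) * n ^_ (2 * t) =
   d ^_ t * (n - d) ^_ t * 'C(n, d))%N.
Proof.
move=> dn tn td; have [ltnd|tnd] := ltnP (n - d)%N t.
  by rewrite bin_small ?(ffact_small ltnd) ?muln0//; lia.
have le1 : (d - t <= n - 2 * t)%N by lia.
have Hn := ffact_fact tn; have Hd := ffact_fact td.
have Hnd := ffact_fact tnd; have Hb := bin_fact dn.
have Hb' := bin_fact le1.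
have eqs : ((n - 2 * t) - (d - t) = n - d - t)%N by lia.
rewrite eqs in Hb'.
apply/eqP; rewrite -(eqn_pmul2r (fact_gt0 (d - t))).
rewrite -(eqn_pmul2r (fact_gt0 (n - d - t))); apply/eqP.
transitivity n`!; first by rewrite -Hn -Hb'; ring.
by rewrite -Hb -Hd -Hnd; ring.
Qed.

(** Deleting X is a bijection from the d-sets that contain X and miss Y onto the
    (d - #|X|)-subsets of the complement of X and Y. *)
Lemma card_draws_separating (T : finType) (X Y : {set T}) (d : nat) :
  [disjoint X & Y] ->
  #|[set S : {set T} | [&& X \subset S, [disjoint Y & S] & #|S| == d]]%SET| =
  (if #|X| <= d then 'C(#|T| - (#|X| + #|Y|), d - #|X|) else 0)%N.
Proof.
move=> XY; case: leqP => [Xd|dX]; last first.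
  apply/eqP; rewrite cards_eq0; apply/eqP/setP => S; rewrite !inE.
  apply/negbTE/negP => /and3P[/subset_leq_card XS _ /eqP Sd].
  by move: XS; rewrite Sd leqNgt dX.
have <- : #|~: (X :|: Y)%SET| = (#|T| - (#|X| + #|Y|))%N.
  rewrite cardsCs finset.setCK; congr (_ - _)%N.
  by apply/eqP; rewrite (leq_card_setU X Y).2.
rewrite -(cards_draws (~: (X :|: Y))%SET) -[RHS](card_in_imset (f := finset.setU X)).
  apply: eq_card => S; rewrite !inE; apply/and3P/imsetP => [[XS YS /eqP Sd]|].
    exists (S :\: X)%SET; last first.
      rewrite finset.setDE finset.setUIr finset.setUCr finset.setIT.
      exact/esym/finset.setUidPr.
    rewrite inE cardsD (finset.setIidPr XS) Sd eqxx andbT.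
    apply/fintype.subsetP => x; rewrite !inE negb_or => /andP[-> /= xS].
    by rewrite (disjointFl YS).
  case=> S'; rewrite !inE => /andP[S'C /eqP S'd] ->; split.
  - exact: finset.subsetUl.
  - rewrite -finset.setI_eq0 finset.setIUr finset.setU_eq0 !finset.setI_eq0.
    rewrite disjoint_sym XY /= disjoint_sym finset.disjoints_subset.
    rewrite (fintype.subset_trans S'C)//.
    by rewrite finset.setCU finset.subsetIr.
  - have XS' : [disjoint X & S'].
      rewrite disjoint_sym finset.disjoints_subset (fintype.subset_trans S'C)//.
      by rewrite finset.setCU finset.subsetIl.
    have /eqP -> : #|X :|: S'|%SET == (#|X| + #|S'|)%N.
      by rewrite (leq_card_setU X S').2.
    by rewrite S'd subnKC.
(* Injectivity: S is recovered from X :|: S because it is disjoint from X. *)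
move=> S1 S2; rewrite !inE => /andP[S1C _] /andP[S2C _] eqU.
have sub (S : {set T}) : S \subset (~: (X :|: Y))%SET -> S = ((X :|: S) :\: X)%SET.
  move=> SC; rewrite finset.setDUl finset.setDv finset.set0U; apply/esym/finset.setDidPl.
  rewrite finset.disjoints_subset (fintype.subset_trans SC)//.
  by rewrite finset.setCU finset.subsetIl.
by rewrite (sub _ S1C) (sub _ S2C) eqU.
Qed.

(** For i < t <= m one has m <= t (m - i), so a falling factorial is at least a
    fixed fraction of the power that it resembles. *)
Lemma expn_le_ffact (m t : nat) : (t <= m)%N -> (m ^ t <= t ^ t * m ^_ t)%N.
Proof.
move=> tm; rewrite ffact_prod.
have -> : (m ^ t = \prod_(i < t) m)%N by rewrite prod_nat_const card_ord.
have -> : (t ^ t = \prod_(i < t) t)%N by rewrite prod_nat_const card_ord.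
by rewrite -big_split /=; apply: leq_prod => i _; have := ltn_ord i; nia.
Qed.

Lemma ffact_le_expn (m t : nat) : (m ^_ t <= m ^ t)%N.
Proof.
rewrite ffact_prod.
have -> : (m ^ t = \prod_(i < t) m)%N by rewrite prod_nat_const card_ord.
by apply: leq_prod => i _; exact: leq_subr.
Qed.

(** * Finite sets of natural numbers *)

Lemma fset_nat_bounded (X : {fset nat}) :
  exists N, forall i, i \in X -> (i < N)%N.
Proof.
exists (\max_(i <- X) i).+1 => i iX.
by rewrite ltnS; apply: (@leq_bigmax_seq _ _ xpredT id).
Qed.

(** Padding with fresh numbers taken from a prescribed window, so that two sets
    can be padded from different windows and stay disjoint. *)
Lemma fset_pad (X : {fset nat}) (N t : nat) :
  (forall i, i \in X -> i < N) -> #|` X| <= t ->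
  exists X' : {fset nat}, [/\ (X `<=` X')%fset, #|` X'| = t &
    forall i, i \in X' -> (i \in X) || (N <= i < N + t)].
Proof.
move=> XN Xt; pose W := [fset i in iota N (t - #|` X|)]%fset.
exists (X `|` W)%fset; split; first exact: fsubsetUl.
  have /eqP XW : (X `&` W == fset0)%fset.
    apply/fset0Pn => -[i]; rewrite !inE mem_iota => /andP[/XN]; lia.
  rewrite cardfsU XW cardfs0 subn0 card_fseq undup_id ?iota_uniq//.
  by rewrite size_iota subnKC.
move=> i; rewrite !inE mem_iota => /orP[->//|] /andP[Ni iN].
by apply/orP; right; lia.
Qed.

(** Reduces pairs with at most [t] elements on each side to pairs with exactly [t],
    whose witness probabilities are given by a single formula. *)
Lemma disjoint_extension (X Y : {fset nat}) (t : nat) :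
  [disjoint X & Y]%fset -> #|` X| <= t -> #|` Y| <= t ->
  exists X' Y' : {fset nat},
    [/\ [disjoint X' & Y']%fset, (X `<=` X')%fset, (Y `<=` Y')%fset,
        #|` X'| = t & #|` Y'| = t].
Proof.
move=> XY Xt Yt.
have [N XYN] := fset_nat_bounded (X `|` Y)%fset.
have XN i : i \in X -> i < N by move=> iX; apply: XYN; rewrite inE iX.
have YN i : i \in Y -> i < N by move=> iY; apply: XYN; rewrite inE iY orbT.
have YNt i : i \in Y -> i < N + t by move/YN; lia.
have [X' [XX' X't X'P]] := fset_pad XN Xt.
have [Y' [YY' Y't Y'P]] := fset_pad YNt Yt.
exists X', Y'; split=> //; apply/fdisjointP => i /X'P iX'.
apply/negP => /Y'P iY'.
case/orP: iX' => [iX|iN]; case/orP: iY' => [iY|iNt]; last lia.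
- by move/fdisjointP: XY => /(_ i iX); rewrite iY.
- have := XN i iX; lia.
- have := YN i iY; lia.
Qed.

(** * Witnesses as events of one round *)

(** The draw of round [n] has type [{set 'I_n}]; sets of vertices are brought to this
    type to be compared with it. *)
Definition trace (X : {fset nat}) (n : nat) : {set 'I_n} :=
  [set j : 'I_n | val j \in X].

Definition separating (X Y : {fset nat}) (n : nat) : {set {set 'I_n}} :=
  [set S : {set 'I_n} | (trace X n \subset S) && [disjoint trace Y n & S]].

Lemma card_trace (X : {fset nat}) (n : nat) :
  (forall i, i \in X -> i < n) -> #|trace X n| = #|` X|.
Proof.
move=> Xn; rewrite cardE -(size_map val); apply: perm_size.
apply: uniq_perm; rewrite ?(map_inj_uniq val_inj) ?enum_uniq ?fset_uniq// => i.
apply/mapP/idP => [[j]|iX]; first by rewrite mem_enum inE => jX ->.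
by exists (Ordinal (Xn i iX)); rewrite // mem_enum inE.
Qed.

Lemma disjoint_trace (X Y : {fset nat}) (n : nat) :
  [disjoint X & Y]%fset -> [disjoint trace X n & trace Y n].
Proof.
move=> /fdisjointP XY; rewrite disjoint_subset; apply/fintype.subsetP => j.
by rewrite !inE => /XY.
Qed.

Lemma double_card_le (X Y : {fset nat}) (n t : nat) :
  [disjoint X & Y]%fset -> #|` X| = t -> #|` Y| = t ->
  (forall i, i \in X -> i < n) -> (forall i, i \in Y -> i < n) -> 2 * t <= n.
Proof.
move=> XY Xt Yt Xn Yn.
rewrite mul2n -addnn -{1}Xt -Yt -(card_trace Xn) -(card_trace Yn).
have /eqP <- : #|trace X n :|: trace Y n| == #|trace X n| + #|trace Y n|.
  by rewrite (leq_card_setU _ _).2 disjoint_trace.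
by rewrite -[leqRHS]card_ord max_card.
Qed.

(** Stated without division; dividing by the number C(n, d) of all draws, it
    identifies the probability that a vertex is a witness with the term of the
    second series. *)
Lemma card_separating (X Y : {fset nat}) (n d t : nat) :
  [disjoint X & Y]%fset -> #|` X| = t -> #|` Y| = t ->
  (forall i, i \in X -> i < n) -> (forall i, i \in Y -> i < n) -> d <= n ->
  #|[set S in separating X Y n | #|S| == d]| * n ^_ (2 * t) =
  d ^_ t * (n - d) ^_ t * 'C(n, d).
Proof.
move=> XY Xt Yt Xn Yn dn.
have tXY := disjoint_trace n XY.
have tn := double_card_le XY Xt Yt Xn Yn.
have -> : #|[set S in separating X Y n | #|S| == d]| =
    if t <= d then 'C(n - 2 * t, d - t) else 0.
  have := card_draws_separating d tXY.
  rewrite card_ord !card_trace// Xt Yt addnn mul2n => <-.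
  by apply: eq_card => S; rewrite !inE andbA.
have [td|dt] := leqP t d; first exact: bin_ffact_separated.
by rewrite (ffact_small dt) !mul0n.
Qed.

(** An edge is always drawn in the round of its later end, so adjacency of [n] to
    an earlier vertex depends on the draw of round [n] alone. *)
Lemma process_adj_earlier (A : forall i : nat, {set 'I_i}) (n : nat) (j : 'I_n) :
  process_adj A n j = (j \in A n).
Proof.
rewrite /process_adj (fintype.mem_image val_inj) orbC -[RHS]orbF; congr orb.
apply/negbTE/fintype.imageP => -[i _ ni]; have := ltn_ord i; have := ltn_ord j.
by rewrite /= in ni; rewrite -ni; lia.
Qed.

(** Once all vertices of the pair have appeared, being a witness for it is an event
    of a single round. This is what makes the witness events independent. *)
Lemma witness_separating (A : forall i : nat, {set 'I_i}) (X Y : {fset nat})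
    (n : nat) :
  (forall i, i \in X -> i < n) -> (forall i, i \in Y -> i < n) ->
  witness (process_graph A) X Y n <-> A n \in separating X Y n.
Proof.
move=> Xn Yn; rewrite inE disjoint_subset; split => [[wX wY]|].
  apply/andP; split; apply/fintype.subsetP => j; rewrite !inE.
    by move=> /wX /=; rewrite process_adj_earlier.
  by move=> /wY /=; rewrite process_adj_earlier.
move=> /andP[/fintype.subsetP wX /fintype.subsetP wY]; split=> i iXY /=.
  rewrite (process_adj_earlier A (Ordinal (Xn i iXY))) wX// inE//.
rewrite (process_adj_earlier A (Ordinal (Yn i iXY))).
by have := wY (Ordinal (Yn i iXY)); rewrite !inE; apply.
Qed.

Lemma witness_sub (V : choiceType) (G : sgraph V) (X X' Y Y' : {fset V}) (v : V) :
  (X `<=` X')%fset -> (Y `<=` Y')%fset ->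
  witness G X' Y' v -> witness G X Y v.
Proof.
move=> /fsubsetP XX' /fsubsetP YY' [wX wY].
by split=> i; [move/XX'; exact: wX|move/YY'; exact: wY].
Qed.

Local Open Scope classical_set_scope.
Local Open Scope ring_scope.
Local Open Scope ereal_scope.

(** * Comparison of the two series *)

Lemma nneseries_pinftyP (R : realType) (f : nat -> R) :
  (forall n, 0 <= f n)%R ->
  \sum_(1 <= n <oo) (f n)%:E = +oo <->
  forall M : R, exists N, (M < \sum_(1 <= n < N) f n)%R.
Proof.
move=> f0; split=> [foo M|fM].
  apply: contrapT => /forallNP noN.
  suff : \sum_(1 <= n <oo) (f n)%:E <= M%:E by rewrite foo leye_eq.
  apply: lime_le; first by apply: is_cvg_nneseries => n _ _; rewrite lee_fin.
  apply: nearW => N; rewrite sumEFin lee_fin leNgt.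
  by apply/negP/noN.
apply: eq_infty => M.
have [N MN] := fM M.
rewrite (@le_trans _ _ (\sum_(1 <= n < N) (f n)%:E))//.
  by rewrite sumEFin lee_fin ltW.
by apply: nneseries_lim_ge => n _ _; rewrite lee_fin.
Qed.

(** Telescoping: 1/(x + 1)^2 <= 1/x - 1/(x + 1). *)
Lemma sum_inv_sq_le (R : realType) (N : nat) :
  (\sum_(1 <= n < N) (n%:R ^- 2) <= 2 :> R)%R.
Proof.
case: N => [|[|N]]; [by rewrite big_geq|by rewrite big_geq|].
(* The sharper bound 2 - 1/(N - 1) is the one that is inductive. *)
suff /le_trans : (\sum_(1 <= n < N.+2) (n%:R ^- 2) <= 2 - N.+1%:R^-1 :> R)%R.
  by apply; rewrite gerBl invr_ge0.
elim: N => [|N IH]; first by rewrite big_nat1 expr1n invr1; lra.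
rewrite big_nat_recr//= (le_trans (lerD IH (lexx _)))//.
rewrite -[N.+2%:R]natr1.
have x0 : (0 < N.+1%:R :> R)%R by rewrite ltr0n.
set x : R := N.+1%:R in x0 *; rewrite -subr_ge0.
have -> : (2 - (x + 1)^-1 - (2 - x^-1 + (x + 1) ^- 2) =
           (x * (x + 1) ^+ 2)^-1)%R.
  by field; lra.
by rewrite invr_ge0 mulr_ge0 ?sqr_ge0// ltW.
Qed.

(** The slack c/n^2 is summable, hence cannot be responsible for the divergence.
    It absorbs the terms of the two series of the theorem that are not comparable
    up to a constant factor. *)
Lemma nneseries_pinfty_comparison (R : realType) (f g : nat -> R) (C c : R)
    (N0 : nat) :
  (0 <= C)%R -> (0 <= c)%R ->
  (forall n, 0 <= f n)%R -> (forall n, 0 <= g n)%R ->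
  (forall n, (0 < n)%N -> (N0 <= n)%N -> f n <= C * g n + c * n%:R ^- 2)%R ->
  \sum_(1 <= n <oo) (f n)%:E = +oo -> \sum_(1 <= n <oo) (g n)%:E = +oo.
Proof.
move=> C0 c0 f0 g0 fg /(nneseries_pinftyP f0) foo.
apply/(nneseries_pinftyP g0) => M.
pose K : R := (\sum_(1 <= n < N0) f n)%R.
have K0 : (0 <= K)%R by apply: sumr_ge0.
have bound N : (\sum_(1 <= n < N) f n <=
    K + (C * \sum_(1 <= n < N) g n + c * \sum_(1 <= n < N) n%:R ^- 2))%R.
  elim: N => [|N IH]; first by rewrite !big_geq// !mulr0 !addr0.
  have [N1|N1] := posnP N; first by rewrite N1 !big_geq// !mulr0 !addr0.
  have [N0N|NN0] := leqP N0 N.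
    rewrite !(big_nat_recr N)//= !mulrDr; have := fg N N1 N0N; lra.
  apply: (@le_trans _ _ K).
    rewrite /K (big_cat_nat _ NN0)//= lerDl; exact: sumr_ge0.
  rewrite lerDl; apply: addr_ge0; apply: mulr_ge0 => //; exact: sumr_ge0.
(* The sum of the n^-2 is at most 2, whence the last term. *)
have [N MN] := foo (K + C * M + c * 2)%R; exists N.
have := lt_le_trans MN (bound N); have sq := @sum_inv_sq_le R N.
have : (c * \sum_(1 <= n < N) n%:R ^- 2 <= c * 2)%R by rewrite ler_wpM2l.
move=> h1 h2; have : (C * M < C * \sum_(1 <= n < N) g n)%R by lra.
by rewrite ltNge => h; rewrite ltNge; apply: contra h => /ler_wpM2l; apply.
Qed.

(** When d and n - d are both at least t, falling factorials and powers agree up to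
    constants, hence so do the terms of the two series. Otherwise the second term
    is zero, and the first is at most (t/n)^t: this is O(1/n^2) if t >= 2, and
    for t = 1 it is zero because d or n - d is. For t = 0 only the first
    case occurs. *)
Lemma k_series_pinfty_iff (R : realType) (d : nat -> nat) (t : nat) :
  (forall n, (d n <= n)%N) ->
  \sum_(1 <= n <oo)
      (((d n)%:R / n%:R) ^+ t * ((n - d n)%:R / n%:R) ^+ t : R)%:E = +oo <->
  \sum_(1 <= n <oo)
      (((d n) ^_ t)%:R * ((n - d n) ^_ t)%:R / (n ^_ (2 * t))%:R : R)%:E = +oo.
Proof.
move=> dle.
have pow_ge0 n : (0 <= ((d n)%:R / n%:R) ^+ t * ((n - d n)%:R / n%:R) ^+ t :> R)%R.
  by rewrite mulr_ge0// exprn_ge0// divr_ge0.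
have ffact_ge0 n : (0 <=
    ((d n) ^_ t)%:R * ((n - d n) ^_ t)%:R / (n ^_ (2 * t))%:R :> R)%R.
  by rewrite divr_ge0// mulr_ge0.
have powE n : (((d n)%:R / n%:R) ^+ t * ((n - d n)%:R / n%:R) ^+ t =
    (d n ^ t * (n - d n) ^ t)%:R / (n ^ (2 * t))%:R :> R)%R.
  by rewrite !expr_div_n mulf_div -exprD addnn -mul2n -!natrX natrM.
split; last first.
  apply: (@nneseries_pinfty_comparison _ _ _ ((2 * t) ^ (2 * t))%:R 0 (2 * t)) => //.
  move=> n n0 tn; rewrite mul0r addr0 powE mulrA -natrM -natrM.
  have np : (0 < (n ^ (2 * t))%:R :> R)%R by rewrite ltr0n expn_gt0 n0.
  have fp : (0 < (n ^_ (2 * t))%:R :> R)%R by rewrite ltr0n ffact_gt0.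
  rewrite ler_pdivrMr// mulrAC ler_pdivlMr// -!natrM ler_nat mulnC.
  have h1 := expn_le_ffact tn.
  have h2 : (d n ^_ t * (n - d n) ^_ t <= d n ^ t * (n - d n) ^ t)%N.
    by rewrite leq_mul// ffact_le_expn.
  by rewrite (leq_trans (leq_mul h1 h2))// mulnAC.
apply: (@nneseries_pinfty_comparison _ _ _ (t ^ t * t ^ t)%:R (t ^ t)%:R 0) => //.
move=> n n0 _; rewrite powE.
have nX0 k : (0 < n%:R ^+ k :> R)%R by rewrite exprn_gt0// ltr0n.
have [/andP[td tnd]|small] := boolP ((t <= d n) && (t <= n - d n))%N.
  have tn : (2 * t <= n)%N by have := dle n; lia.
  have np : (0 < (n ^ (2 * t))%:R :> R)%R by rewrite ltr0n expn_gt0 n0.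
  have fp : (0 < (n ^_ (2 * t))%:R :> R)%R by rewrite ltr0n ffact_gt0.
  rewrite ler_wpDr ?divr_ge0 ?(ltW (nX0 2%N))//.
  rewrite mulrA -!natrM ler_pdivrMr// mulrAC ler_pdivlMr// -!natrM ler_nat.
  apply: leq_mul; last exact: ffact_le_expn.
  rewrite mulnACA; exact: leq_mul (expn_le_ffact td) (expn_le_ffact tnd).
rewrite -[leLHS]add0r; apply: lerD; first by rewrite mulr_ge0.
case: t small {pow_ge0 ffact_ge0 powE} => [|[|t]] small.
- by [].
- have -> : (d n ^ 1 * (n - d n) ^ 1 = 0)%N by have := dle n; lia.
  by rewrite mul0r divr_ge0// ltW.
rewrite ler_pdivrMr ?natrX// mulrAC ler_pdivlMr// -!natrX -!natrM ler_nat.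
have le_n : (n ^ t.+2 * n ^ 2 <= n ^ (2 * t.+2))%N.
  by rewrite -expnD leq_pexp2l//; lia.
have le_dn : (d n ^ t.+2 * (n - d n) ^ t.+2 <= t.+2 ^ t.+2 * n ^ t.+2)%N.
  have pow_lt m : ~~ (t.+2 <= m)%N -> (m ^ t.+2 <= t.+2 ^ t.+2)%N.
    by rewrite -ltnNge leq_exp2r//; exact: ltnW.
  case/nandP: small => /pow_lt small.
    have /(leq_mul small) // : ((n - d n) ^ t.+2 <= n ^ t.+2)%N.
    by rewrite leq_exp2r// leq_subr.
  rewrite mulnC; have /(leq_mul small) // : (d n ^ t.+2 <= n ^ t.+2)%N.
  by rewrite leq_exp2r.
by rewrite (leq_trans (leq_mul le_dn (leqnn _)))// -mulnA leq_mul.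
Qed.

(** * Almost sure statements and the Borel-Cantelli lemmas *)

(** First Borel-Cantelli lemma, read pointwise: a point outside the upper limit of
    the [F n], which is a null set, lies in finitely many of them. *)
Lemma borel_cantelli_ae_finite {disp : measure_display}
    {Omega : measurableType disp} {R : realType}
    (mu : {measure set Omega -> \bar R}) (F : nat -> set Omega) :
  (forall n, measurable (F n)) -> \sum_(0 <= n <oo) mu (F n) < +oo ->
  {ae mu, forall w, finite_set [set n | F n w]}.
Proof.
move=> mF Fsum; exists (lim_sup_set F); split.
- by apply: bigcap_measurable => // k _; exact: bigcup_measurable.
- exact: lim_sup_set_cvg0.
move=> w /= Finf n _; apply: contrapT => Fn; apply: Finf.
apply: (@sub_finite_set _ _ `I_n) => // k /= Fk.
by rewrite ltnNge; apply/negP => nk; apply: Fn; exists k.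
Qed.

(** A polynomial substitute for the bound of the product by exp(- sum p): it follows
    by induction from (1 - p)(1 + s + p) <= 1 + s for p, s >= 0. *)
Lemma prod_onem_sum_le1 (R : realType) (p : nat -> R) (m N : nat) :
  (forall i, 0 <= p i <= 1)%R ->
  ((\prod_(m <= i < N) (1 - p i)) * (1 + \sum_(m <= i < N) p i) <= 1)%R.
Proof.
move=> p01; case: (leqP N m) => [Nm|/ltnW]; first by rewrite !big_geq//; lra.
elim: N => [|N IH]; first by rewrite leqn0 => /eqP ->; rewrite !big_geq//; lra.
rewrite leq_eqVlt => /predU1P[->|]; first by rewrite !big_geq//; lra.
rewrite ltnS => mN; rewrite !big_nat_recr//=; have {IH} := IH mN.
have : (0 <= \prod_(m <= i < N) (1 - p i))%R.
  by apply: prodr_ge0 => i _; have := p01 i; lra.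
have : (0 <= \sum_(m <= i < N) p i)%R.
  by apply: sumr_ge0 => i _; have /andP[] := p01 i.
have := p01 N; set x := p N; set s := (\sum_(_ <= _ < _) _)%R.
set q := (\prod_(_ <= _ < _) _)%R => /andP[x0 x1] s0 q0 IH.
apply: le_trans IH; rewrite -mulrA ler_wpM2l//; nra.
Qed.

(** Second Borel-Cantelli lemma. Independence is assumed for the complements, as
    only the probability that none of the events in a block occurs is used: by
    [prod_onem_sum_le1] that probability is at most 1/(1 + s), with s the sum of
    the probabilities over the block, and s is unbounded. *)
Lemma borel_cantelli_ae_infinite {disp : measure_display}
    {Omega : measurableType disp} {R : realType}
    (P : probability Omega R) (F : nat -> set Omega) :
  (forall n, measurable (F n)) ->
  (forall J : {fset nat}, P (\bigcap_(i in [set` J]) ~` F i) =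
     \prod_(i <- enum_fset J) P (~` F i)) ->
  \sum_(1 <= n <oo) P (F n) = +oo ->
  {ae P, forall w, cardinality.infinite_set [set n | F n w]}.
Proof.
move=> mF indep Fsum.
pose p n := fine (P (F n)).
have pE n : (p n)%:E = P (F n) by rewrite fineK ?fin_num_measure.
have p01 n : (0 <= p n <= 1)%R by rewrite -!lee_fin pE measure_ge0 probability_le1.
have p0 n : (0 <= p n)%R by case/andP: (p01 n).
have poo : \sum_(1 <= n <oo) (p n)%:E = +oo.
  by rewrite -Fsum; apply: eq_eseriesr.
have {}poo := (nneseries_pinftyP p0).1 poo.
(* A subset of nat that meets every final segment is infinite. *)
suff unb m : {ae P, forall w, exists2 n, (m < n)%N & F n w}.
  have := ae_foralln unb; apply: filterS => w Fw /= /finite_fsetP[X FX].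
  have [N XN] := fset_nat_bounded X; have [n Nn Fn] := Fw N.
  have : [set` X] n by rewrite -FX.
  by move=> /= /XN; rewrite ltnNge ltnW.
set I := \bigcap_(i in [set i | (m < i)%N]) ~` F i.
have mI : measurable I.
  by apply: bigcap_measurable => [|i _]; [exists m.+1 => /=|exact: measurableC].
exists I; split => //; last first.
  by move=> w /= nF i mi Fi; apply: nF; exists i.
apply/eqP; rewrite eq_le measure_ge0 andbT leNgt; apply/negP.
pose c := fine (P I).
have PI : c%:E = P I by rewrite fineK ?fin_num_measure.
rewrite -PI lte_fin => c0.
have cle N : (c * (1 + \sum_(m.+1 <= i < N) p i) <= 1)%R.
  apply: le_trans (prod_onem_sum_le1 m.+1 N p01).
  rewrite ler_wpM2r ?addr_ge0 ?sumr_ge0// -lee_fin PI.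
  pose J := [fset i in index_iota m.+1 N]%fset.
  apply: (@le_trans _ _ (P (\bigcap_(i in [set` J]) ~` F i))).
    apply: le_measure; rewrite ?inE//.
      by apply: fin_bigcap_measurable => // i _; exact: measurableC.
    by move=> w Iw i /=; rewrite !inE mem_index_iota => /andP[mi _]; exact: Iw.
  rewrite indep (perm_big (index_iota m.+1 N)) /=; last first.
    by apply: uniq_perm; rewrite ?fset_uniq ?iota_uniq// => i; rewrite !inE.
  rewrite (big_morph EFin EFinM erefl) le_eqVlt; apply/orP; left; apply/eqP.
  by apply: eq_bigr => i _; rewrite probability_setC// -pE.
(* A block whose sum exceeds 1/c contradicts [cle]; the first m probabilities
   are added since the divergent series starts before the block. *)
have [N] := poo (\sum_(1 <= i < m.+1) p i + c^-1)%R.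
have [mN|/ltnW Nm] := leqP m.+1 N; last first.
  have [->|N0] := posnP N.
    by rewrite [ltRHS]big_geq// ltNge addr_ge0 ?sumr_ge0// invr_ge0 ltW.
  rewrite (big_cat_nat _ Nm)//= -addrA gtrDl ltNge => /negP; case.
  by rewrite addr_ge0 ?sumr_ge0// invr_ge0 ltW.
rewrite (big_cat_nat _ mN)//= ltrD2l => h; have := cle N.
rewrite -ler_pdivlMl// mulr1 leNgt => /negP; apply.
by rewrite (lt_le_trans h)// lerDr.
Qed.

Lemma ae_forall_countable {disp : measure_display}
    {T : measurableType disp} {R : realType}
    (mu : {measure set T -> \bar R}) (C : countType) (Q : C -> T -> Prop) :
  (forall c, {ae mu, forall x, Q c x}) -> {ae mu, forall x, forall c, Q c x}.
Proof.
move=> aeQ; pose Q' k x := if choice.unpickle k is Some c then Q c x else True.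
have : {ae mu, forall x, forall k, Q' k x}.
  apply: ae_foralln => k; rewrite /Q'; case: choice.unpickle => [c|].
    exact: aeQ.
  exact: aeW.
apply: filterS => x Qx c; have := Qx (choice.pickle c).
by rewrite /Q' choice.pickleK.
Qed.

Lemma infinite_set_eventually_sub (S T : set nat) (N : nat) :
  (forall n, (N <= n)%N -> S n -> T n) ->
  cardinality.infinite_set S -> cardinality.infinite_set T.
Proof.
move=> ST Sinf Tfin; apply: Sinf.
apply: (@sub_finite_set _ _ (T `|` `I_N)); last by rewrite finite_setU.
by move=> n Sn; have [nN|/(ST n)] := ltnP n N; [right|left; auto].
Qed.

(** * Witnesses in the random graph process *)

Lemma process_measurable_in (R : realType) (d : nat -> nat)
    (disp : measure_display) (Omega : measurableType disp)
    (P : probability Omega R) (A : forall i : nat, Omega -> {set 'I_i}) :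
  random_graph_process d P A ->
  forall n (B : {set {set 'I_n}}), measurable [set w | A n w \in B].
Proof.
move=> [mA _ _] n B.
rewrite (_ : mkset _ = \bigcup_(S in [set` B]) [set w | A n w = S]).
  by apply: fin_bigcup_measurable.
by apply/seteqP; split => [w wB|w [S SB /= AS]]; [exists (A n w)|rewrite AS].
Qed.

Lemma process_probability_in (R : realType) (d : nat -> nat)
    (disp : measure_display) (Omega : measurableType disp)
    (P : probability Omega R) (A : forall i : nat, Omega -> {set 'I_i}) :
  random_graph_process d P A ->
  forall n (B : {set {set 'I_n}}), P [set w | A n w \in B] =
    (#|[set S in B | #|S| == d n]%SET|%:R / ('C(n, d n))%:R)%:E.
Proof.
move=> [mA uA _] n B.
rewrite (_ : mkset _ = \bigcup_(S in [set` enum B]) [set w | A n w = S]); last first.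
  apply/seteqP; split => [w wB|w [S /= SB AS]]; last by rewrite AS -mem_enum.
  by exists (A n w) => //=; rewrite mem_enum.
rewrite measure_fin_bigcup//; last first.
  by move=> S S' _ _ [w [/= <- <-]].
rewrite -fsbig_seq ?enum_uniq// big_enum/=.
under eq_bigr do rewrite uA card_draws card_ord.
rewrite -big_mkcondr /= sumEFin; congr EFin.
rewrite mulr_natl -sumr_const; apply: eq_bigl => S.
by rewrite inE.
Qed.

Lemma probability_separating (R : realType) (d : nat -> nat)
    (disp : measure_display) (Omega : measurableType disp)
    (P : probability Omega R) (A : forall i : nat, Omega -> {set 'I_i})
    (X Y : {fset nat}) (n t : nat) :
  random_graph_process d P A ->
  [disjoint X & Y]%fset -> #|` X| = t -> #|` Y| = t ->
  (forall i, i \in X -> (i < n)%N) -> (forall i, i \in Y -> (i < n)%N) ->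
  (d n <= n)%N ->
  P [set w | A n w \in separating X Y n] =
    (((d n) ^_ t)%:R * ((n - d n) ^_ t)%:R / (n ^_ (2 * t))%:R)%:E.
Proof.
move=> procA XY Xt Yt Xn Yn dn; rewrite (process_probability_in procA).
have binp : ('C(n, d n)%:R != 0 :> R)%R by rewrite pnatr_eq0 -lt0n bin_gt0.
have tn := double_card_le XY Xt Yt Xn Yn.
have ffp : ((n ^_ (2 * t))%:R != 0 :> R)%R by rewrite pnatr_eq0 -lt0n ffact_gt0.
congr EFin; apply/eqP; rewrite eqr_div//; apply/eqP.
by rewrite -!natrM (card_separating XY Xt Yt Xn Yn dn).
Qed.

(** A zero-one law for a single pair: which alternative holds depends on the size
    [t] and on the sequence, not on the pair. Vertices up to the largest element of
    the pair are not governed by the probability formula, but they are finitely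
    many and affect neither side. *)
Lemma borel_cantelli_separating (R : realType) (d : nat -> nat)
    (disp : measure_display) (Omega : measurableType disp)
    (P : probability Omega R) (A : forall i : nat, Omega -> {set 'I_i})
    (X Y : {fset nat}) (t : nat) :
  (forall n, (d n <= n)%N) -> random_graph_process d P A ->
  [disjoint X & Y]%fset -> #|` X| = t -> #|` Y| = t ->
  {ae P, forall w,
    cardinality.infinite_set
      [set n | witness (process_graph (fun i => A i w)) X Y n] <->
    \sum_(1 <= n <oo)
      (((d n) ^_ t)%:R * ((n - d n) ^_ t)%:R / (n ^_ (2 * t))%:R : R)%:E = +oo}.
Proof.
move=> dle procA XY Xt Yt.
have [N XYN] := fset_nat_bounded (X `|` Y)%fset.
have Xlt n : (N <= n)%N -> forall i, i \in X -> (i < n)%N.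
  by move=> Nn i iX; apply: leq_trans Nn; apply: XYN; rewrite inE iX.
have Ylt n : (N <= n)%N -> forall i, i \in Y -> (i < n)%N.
  by move=> Nn i iY; apply: leq_trans Nn; apply: XYN; rewrite inE iY orbT.
pose F n := [set w | A n w \in separating X Y n].
have mF n : measurable (F n) := process_measurable_in procA (separating X Y n).
have WF w n : (N <= n)%N ->
    witness (process_graph (fun i => A i w)) X Y n <-> F n w.
  by move=> Nn; apply: witness_separating; [exact: Xlt|exact: Ylt].
pose q n := (((d n) ^_ t)%:R * ((n - d n) ^_ t)%:R / (n ^_ (2 * t))%:R : R)%R.
have q0 n : (0 <= q n)%R by rewrite divr_ge0// mulr_ge0.
pose p n := fine (P (F n)).
have pE n : (p n)%:E = P (F n) by rewrite fineK ?fin_num_measure.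
have p0 n : (0 <= p n)%R by rewrite -lee_fin pE measure_ge0.
have pq n : (N <= n)%N -> p n = q n.
  move=> Nn; rewrite /p (probability_separating procA XY Xt Yt)//.
  - exact: Xlt.
  - exact: Ylt.
have [qoo|qfin] := pselect (\sum_(1 <= n <oo) (q n)%:E = +oo).
  have Foo : \sum_(1 <= n <oo) P (F n) = +oo.
    rewrite -[LHS](eq_eseriesr (f := fun n => (p n)%:E)); last by move=> n _; rewrite pE.
    apply: (nneseries_pinfty_comparison (C := 1) (c := 0) (N0 := N)) qoo => //.
    by move=> n _ Nn; rewrite mul1r mul0r addr0 pq.
  have indep (J : {fset nat}) : P (\bigcap_(i in [set` J]) ~` F i) =
      \prod_(i <- enum_fset J) P (~` F i).
    have FC i : ~` F i = [set w | A i w \in (~: separating X Y i)%SET].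
      by apply/seteqP; split => w /=; rewrite inE => /negP.
    under eq_bigcapr do rewrite FC.
    under [RHS]eq_bigr do rewrite FC.
    exact: (process_independent procA).
  apply: filterS (borel_cantelli_ae_infinite mF indep Foo) => w Finf.
  by split=> // _; apply: infinite_set_eventually_sub Finf => n /(WF w n) [].
have Ffin : \sum_(0 <= n <oo) P (F n) < +oo.
  rewrite (nneseries_split 0 1)// big_nat1 add0n -pE lte_add_pinfty ?ltry// ltey.
  apply/eqP => Foo; apply: qfin.
  apply: (nneseries_pinfty_comparison (f := p) (C := 1) (c := 0) (N0 := N)) => //.
    by move=> n _ Nn; rewrite mul1r mul0r addr0 pq.
  by rewrite -[RHS]Foo; apply: eq_eseriesr.
apply: filterS (borel_cantelli_ae_finite mF Ffin) => w Fw; split=> // Winf.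
by case: (infinite_set_eventually_sub (N := N) _ Winf Fw) => n /(WF w n) [].
Qed.

(** * The radocity *)

Theorem theorem2p3 (R : realType) (d : nat -> nat)
    (hd : forall n : nat, (d n <= n)%N) :
  k1 R d = k2 R d /\
  forall (disp : measure_display) (Omega : measurableType disp)
    (P : probability Omega R) (A : forall i : nat, Omega -> {set 'I_i}),
    random_graph_process d P A ->
    {ae P, forall w : Omega,
      radocity R (process_graph (fun i : nat => A i w)) = k1 R d}.
Proof.
have k12 : k1 R d = k2 R d.
  congr (nat_sup R _); apply/seteqP.
  by split=> t /= /(k_series_pinfty_iff R t hd).
split=> // disp Omega P A procA; rewrite k12.
(* It is enough that the two sets of integers of which the suprema are taken
   coincide almost surely. *)
suff : {ae P, forall w, forall t : nat, k_rado (process_graph (fun i => A i w)) t <->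
    \sum_(1 <= n <oo)
      (((d n) ^_ t)%:R * ((n - d n) ^_ t)%:R / (n ^_ (2 * t))%:R : R)%:E = +oo}.
  apply: filterS => w rado; congr (nat_sup R _).
  by apply/seteqP; split => t /= /rado.
pose good w (c : {fset nat} * {fset nat} * nat) :=
  [disjoint c.1.1 & c.1.2]%fset -> #|` c.1.1| = c.2 -> #|` c.1.2| = c.2 ->
  cardinality.infinite_set
    [set n | witness (process_graph (fun i => A i w)) c.1.1 c.1.2 n] <->
  \sum_(1 <= n <oo)
    (((d n) ^_ c.2)%:R * ((n - d n) ^_ c.2)%:R / (n ^_ (2 * c.2))%:R : R)%:E = +oo.
have : {ae P, forall w, forall c, good w c}.
  apply: ae_forall_countable => -[[X Y] t].
  have [[XY Xt Yt]|nXY] :=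
      pselect [/\ [disjoint X & Y]%fset, #|` X| = t & #|` Y| = t].
    have := borel_cantelli_separating hd procA XY Xt Yt.
    by apply: filterS => w Hw _ _ _.
  by apply: aeW => w XY Xt Yt; case: nXY.
apply: filterS => w allgood t; pose goodt X Y := allgood (X, Y, t).
split=> [rado|qoo X Y XY Xt Yt].
  (* For this direction a single pair of size t is enough. *)
  pose X := [fset i in iota 0 t]%fset; pose Y := [fset i in iota t t]%fset.
  have XY : [disjoint X & Y]%fset.
    by apply/fdisjointP => i; rewrite !inE !mem_iota; lia.
  have Xt : #|` X| = t by rewrite card_fseq undup_id ?iota_uniq ?size_iota.
  have Yt : #|` Y| = t by rewrite card_fseq undup_id ?iota_uniq ?size_iota.
  by apply/(goodt X Y) => //; apply: rado; rewrite ?Xt ?Yt.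
have [X' [Y' [XY' XX' YY' Xt' Yt']]] := disjoint_extension XY Xt Yt.
apply: sub_infinite_set ((goodt X' Y' XY' Xt' Yt').2 qoo) => n.
exact: witness_sub.
Qed.
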